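(* Let $F$ be a field of characteristic $0$. The square formed by $d:C_4(\mathbb{A}^2_{F[\varepsilon]_2})\to C_3(\mathbb{A}^2_{F[\varepsilon]_2})$, $\tau^2_{1,\varepsilon}:C_4(\mathbb{A}^2_{F[\varepsilon]_2})\to T\mathcal{B}_2(F)$, $\tau^2_{0,\varepsilon}:C_3(\mathbb{A}^2_{F[\varepsilon]_2})\to (F\otimes F^\times)\oplus\bigwedge^2F$ and $\partial_\varepsilon:T\mathcal{B}_2(F)\to (F\otimes F^\times)\oplus\bigwedge^2F$ is commutative, i.e. $$\tau^2_{0,\varepsilon}\circ d=\partial_\varepsilon\circ\tau^2_{1,\varepsilon}\quad\text{on } C_4(\mathbb{A}^2_{F[\varepsilon]_2}).$$
   Context: Tensor and exterior products are over $\mathbb{Z}$. $F[\varepsilon]_2=F[\varepsilon]/\varepsilon^2$. **Configurations.** $C_m(\mathbb{A}^2_{F[\varepsilon]_2})$ is the free abelian group generated by configurations of $m$ vectors $(l^*_0,\dots,l^*_{m-1})$ of $F[\varepsilon]_2^2$ modulo the diagonal action of $GL_2(F[\varepsilon]_2)$, in generic position. Write $l^*_i=l_i+l_{i,\varepsilon}\varepsilon$ with $l_i,l_{i,\varepsilon}\in F^2$, $l_i\neq 0$. Generic position means $\Delta(l_i,l_j)\neq0$ for $i\ne j$, where $\Delta$ is the $2\times2$ determinant. Put $\Delta(l^*_i,l^*_j)_\varepsilon=\Delta(l_{i,\varepsilon},l_j)+\Delta(l_i,l_{j,\varepsilon})$, so $\Delta(l^*_i,l^*_j)=\Delta(l_i,l_j)+\Delta(l^*_i,l^*_j)_\varepsilon\varepsilon$.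 The differential is $d(l^*_0,\dots,l^*_{m-1})=\sum_{i=0}^{m-1}(-1)^i(l^*_0,\dots,\widehat{l^*_i},\dots,l^*_{m-1})$. **Cross-ratio.** $\mathbf{r}(l^*_0,\dots,l^*_3)=\dfrac{\Delta(l^*_0,l^*_3)\Delta(l^*_1,l^*_2)}{\Delta(l^*_0,l^*_2)\Delta(l^*_1,l^*_3)}=r(l_0,\dots,l_3)+r_\varepsilon(l^*_0,\dots,l^*_3)\,\varepsilon$ in $F[\varepsilon]_2$. **The group $T\mathcal{B}_2(F)$.** It is the $\mathbb{Z}$-module generated by the elements $\langle a;a']:=[a+a'\varepsilon]-[a]\in\mathbb{Z}[F[\varepsilon]_2]$ ($a,a'\in F$, $a\ne0,1$) modulo the five-term relations $$\langle a;a']-\langle b;b']+\Big\langle\tfrac ba;\big(\tfrac ba\big)'\Big]-\Big\langle\tfrac{1-b}{1-a};\big(\tfrac{1-b}{1-a}\big)'\Big]+\Big\langle\tfrac{a(1-b)}{b(1-a)};\big(\tfrac{a(1-b)}{b(1-a)}\big)'\Big]=0,\qquad a,b\neq0,1,\ a\neq b,$$ with $\big(\tfrac ba\big)'=\tfrac{ab'-a'b}{a^2}$, $\big(\tfrac{1-b}{1-a}\big)'=\tfrac{(1-b)a'-(1-a)b'}{(1-a)^2}$, $\big(\tfrac{a(1-b)}{b(1-a)}\big)'=\tfrac{b(1-b)a'-a(1-a)b'}{(b(1-a))^2}$. The class of $\langle a;b]$ is written $\langle a;b]_2$. **Maps.** $$\partial_\varepsilon(\langle a;b]_2)=\Big(\tfrac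 ba\otimes(1-a)+\tfrac b{1-a}\otimes a\Big)+\Big(\tfrac b{1-a}\wedge\tfrac ba\Big).$$ $\tau^2_{1,\varepsilon}(l^*_0,\dots,l^*_3)=\langle r(l_0,\dots,l_3);r_\varepsilon(l^*_0,\dots,l^*_3)]_2$. $\tau^2_{0,\varepsilon}=\tau^{(1)}+\tau^{(2)}$ with $$\tau^{(1)}(l^*_0,l^*_1,l^*_2)=\tfrac{\Delta(l^*_1,l^*_2)_\varepsilon}{\Delta(l_1,l_2)}\otimes\tfrac{\Delta(l_0,l_2)}{\Delta(l_0,l_1)}-\tfrac{\Delta(l^*_0,l^*_2)_\varepsilon}{\Delta(l_0,l_2)}\otimes\tfrac{\Delta(l_1,l_2)}{\Delta(l_1,l_0)}+\tfrac{\Delta(l^*_0,l^*_1)_\varepsilon}{\Delta(l_0,l_1)}\otimes\tfrac{\Delta(l_2,l_1)}{\Delta(l_2,l_0)},$$ $$\tau^{(2)}(l^*_0,l^*_1,l^*_2)=\tfrac{\Delta(l^*_0,l^*_1)_\varepsilon}{\Delta(l_0,l_1)}\wedge\tfrac{\Delta(l^*_1,l^*_2)_\varepsilon}{\Delta(l_1,l_2)}-\tfrac{\Delta(l^*_0,l^*_1)_\varepsilon}{\Delta(l_0,l_1)}\wedge\tfrac{\Delta(l^*_0,l^*_2)_\varepsilon}{\Delta(l_0,l_2)}+\tfrac{\Delta(l^*_1,l^*_2)_\varepsilon}{\Delta(l_1,l_2)}\wedge\tfrac{\Delta(l^*_0,l^*_2)_\varepsilon}{\Delta(l_0,l_2)}.$$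 *)

(* Defs.v *)
From HB Require Import structures.
From mathcomp.multinomials Require Import freeg.
From mathcomp Require Import all_boot all_order all_algebra.
From mathcomp Require Import generic_quotient ring_quotient boolp ring.

Set Implicit Arguments.
Unset Strict Implicit.
Unset Printing Implicit Defensive.

Import GRing.Theory.
Local Open Scope ring_scope.
Local Open Scope quotient_scope.

(** * Abelian groups: free groups, quotients, tensor and exterior products *)

(* The additive extension of f to the free abelian group {freeg K}. *)
Definition zlift (K : choiceType) (M : zmodType) (f : K -> M) :
  {freeg K} -> M := fglift (f : K -> zmodule M).

Section ZLift.
Variables (K : choiceType) (M : zmodType) (f : K -> M).

Lemma zlift_is_zmod_morphism : zmod_morphism (zlift f).
Proof. exact: (@lift_is_additive _ K (zmodule M)). Qed.

HB.instance Definition _ :=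
  GRing.isZmodMorphism.Build {freeg K} M (zlift f) zlift_is_zmod_morphism.

Lemma zliftU (k : K) : zlift f << k >> = f k.
Proof. by rewrite /zlift liftU scale1r. Qed.

End ZLift.

Lemma eq_from_freeg (K : choiceType) (M : zmodType)
    (f g : {additive {freeg K} -> M}) :
  (forall k, f << k >> = g << k >>) -> f =1 g.
Proof.
move=> fg x; rewrite -(freeg_sumE x) !raddf_sum; apply: eq_bigr => k _.
by rewrite -[coeff k x]intz -freegU_mulz !raddfMz fg.
Qed.

(* The subgroup generated by S. *)
Inductive in_zspan (A : zmodType) (S : A -> Prop) : A -> Prop :=
  | in_zspan0 : in_zspan S 0
  | in_zspanB x y : in_zspan S x -> in_zspan S y -> in_zspan S (x - y)
  | in_zspan_gen x : S x -> in_zspan S x.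

Definition zspan (A : zmodType) (S : A -> Prop) : {pred A} :=
  fun x => `[< in_zspan S x >].

Section ZSpan.
Variables (A : zmodType) (S : A -> Prop).

Lemma zspanP x : reflect (in_zspan S x) (x \in zspan S).
Proof. exact: asboolP. Qed.

Lemma zspan_zmod_closed : zmod_closed (zspan S).
Proof.
split=> [|x y /zspanP xS /zspanP yS]; apply/zspanP; first exact: in_zspan0.
exact: in_zspanB.
Qed.

HB.instance Definition _ := GRing.isZmodClosed.Build A (zspan S)
  zspan_zmod_closed.

Lemma mem_zspan x : S x -> x \in zspan S.
Proof. by move=> Sx; apply/zspanP/in_zspan_gen. Qed.

End ZSpan.

(* The quotient of A by the subgroup generated by the relators S. *)
Definition zquot (A : zmodType) (S : A -> Prop) := Quotient.quot (zspan S).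

HB.instance Definition _ (A : zmodType) (S : A -> Prop) :=
  GRing.Zmodule.on (zquot S).

Definition zcl (A : zmodType) (S : A -> Prop) (x : A) : zquot S :=
  \pi_(Quotient.quot (zspan S)) x.

(* The map induced on the quotient by an additive f killing the relators. *)
Definition qlift (A B : zmodType) (S : A -> Prop) (f : {additive A -> B})
  (fS : forall x, S x -> f x = 0) : zquot S -> B := fun q => f (repr q).

Section ZQuot.
Variables (A B : zmodType) (S : A -> Prop) (f : {additive A -> B}).
Hypothesis fS : forall x, S x -> f x = 0.

Lemma zcl_is_zmod_morphism : zmod_morphism (@zcl A S).
Proof. exact: (raddfB \pi_(Quotient.quot (zspan S))). Qed.

HB.instance Definition _ :=
  GRing.isZmodMorphism.Build A (zquot S) (@zcl A S) zcl_is_zmod_morphism.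

Lemma zcl_surj (q : zquot S) : exists x, q = zcl S x.
Proof. by exists (repr q); rewrite /zcl reprK. Qed.

Lemma zcl_rel x : S x -> zcl S x = 0.
Proof.
move=> Sx; rewrite -(raddf0 (@zcl A S)); apply/eqP.
by rewrite /zcl -Quotient.idealrBE subr0 mem_zspan.
Qed.

Lemma qliftE x : qlift fS (zcl S x) = f x.
Proof.
apply/eqP; rewrite -subr_eq0 /qlift -raddfB; apply/eqP.
have : repr (zcl S x) - x \in zspan S.
  by rewrite Quotient.idealrBE reprK /zcl.
move/zspanP; elim=> [|y z _ fy _ fz|y]; rewrite ?raddf0 //; last exact: fS.
by rewrite raddfB fy fz subrr.
Qed.

Lemma qlift_is_zmod_morphism : zmod_morphism (qlift fS).
Proof.
move=> p q; have [x ->] := zcl_surj p; have [y ->] := zcl_surj q.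
by rewrite -raddfB !qliftE raddfB.
Qed.

HB.instance Definition _ :=
  GRing.isZmodMorphism.Build (zquot S) B (qlift fS) qlift_is_zmod_morphism.

End ZQuot.

Section Tensor.
Variables A B : zmodType.

Inductive bilinear_relator : {freeg (A * B)%type} -> Prop :=
  | bilinear_l a a' b :
      bilinear_relator (<< (a + a', b) >> - << (a, b) >> - << (a', b) >>)
  | bilinear_r a b b' :
      bilinear_relator (<< (a, b + b') >> - << (a, b) >> - << (a, b') >>).

End Tensor.

Definition tensor (A B : zmodType) := zquot (@bilinear_relator A B).
HB.instance Definition _ (A B : zmodType) := GRing.Zmodule.on (tensor A B).

HB.lock Definition tens (A B : zmodType) (a : A) (b : B) : tensor A B :=
  zcl (@bilinear_relator A B) << (a, b) >>.

Notation "a ⊗ b" := (tens a b) (at level 40, left associativity) : ring_scope.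

Section TensorTheory.
Variables A B : zmodType.
Implicit Types (a : A) (b : B).

Lemma tens_l_subproof b : zmod_morphism (@tens A B ^~ b).
Proof.
have tD x y : (x + y) ⊗ b = x ⊗ b + y ⊗ b.
  rewrite tens.unlock; have := zcl_rel (bilinear_l x y b); rewrite !raddfB /= -addrA -opprD.
  by move/subr0_eq.
by move=> x y; apply/eqP; rewrite eq_sym subr_eq -tD subrK.
Qed.

Lemma tens_r_subproof a : zmod_morphism (@tens A B a).
Proof.
have tD x y : a ⊗ (x + y) = a ⊗ x + a ⊗ y.
  rewrite tens.unlock; have := zcl_rel (bilinear_r a x y); rewrite !raddfB /= -addrA -opprD.
  by move/subr0_eq.
by move=> x y; apply/eqP; rewrite eq_sym subr_eq -tD subrK.
Qed.

HB.instance Definition _ a :=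
  GRing.isZmodMorphism.Build B (tensor A B) (@tens A B a) (tens_r_subproof a).

Lemma tensBl b : {morph @tens A B ^~ b : x y / x - y}.
Proof. exact: tens_l_subproof. Qed.
Lemma tensBr a : {morph @tens A B a : x y / x - y}.
Proof. exact: raddfB. Qed.
Lemma tens0l b : (0 : A) ⊗ b = 0.
Proof. by rewrite -(subrr 0) tensBl subrr. Qed.
Lemma tens0r a : a ⊗ (0 : B) = 0.
Proof. exact: raddf0. Qed.
Lemma tensNl b : {morph @tens A B ^~ b : x / - x}.
Proof. by move=> x; rewrite -sub0r tensBl tens0l sub0r. Qed.
Lemma tensNr a : {morph @tens A B a : x / - x}.
Proof. exact: raddfN. Qed.
Lemma tensDl b : {morph @tens A B ^~ b : x y / x + y}.
Proof. by move=> x y; rewrite -{1}(opprK y) tensBl tensNl opprK. Qed.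
Lemma tensDr a : {morph @tens A B a : x y / x + y}.
Proof. exact: raddfD. Qed.

End TensorTheory.

Section Ext2.
Variable A : zmodType.

Definition alternating_relator (t : tensor A A) : Prop :=
  exists a, t = a ⊗ a.

End Ext2.

Definition ext2 (A : zmodType) := zquot (@alternating_relator A).
HB.instance Definition _ (A : zmodType) := GRing.Zmodule.on (ext2 A).

HB.lock Definition wedge (A : zmodType) (a b : A) : ext2 A :=
  zcl (@alternating_relator A) (a ⊗ b).

Notation "a ⋀ b" := (wedge a b) (at level 40, left associativity) : ring_scope.

Section Ext2Theory.
Variable A : zmodType.
Implicit Types a b : A.

Lemma wedgexx a : a ⋀ a = 0.
Proof. by rewrite wedge.unlock; apply: zcl_rel; exists a. Qed.
Lemma wedgeBl b : {morph @wedge A ^~ b : x y / x - y}.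
Proof. by move=> x y; rewrite wedge.unlock tensBl raddfB. Qed.
Lemma wedgeBr a : {morph @wedge A a : x y / x - y}.
Proof. by move=> x y; rewrite wedge.unlock tensBr raddfB. Qed.
Lemma wedgeNl b : {morph @wedge A ^~ b : x / - x}.
Proof. by move=> x; rewrite wedge.unlock tensNl raddfN. Qed.
Lemma wedgeNr a : {morph @wedge A a : x / - x}.
Proof. by move=> x; rewrite wedge.unlock tensNr raddfN. Qed.
Lemma wedgeDl b : {morph @wedge A ^~ b : x y / x + y}.
Proof. by move=> x y; rewrite wedge.unlock tensDl raddfD. Qed.
Lemma wedgeDr a : {morph @wedge A a : x y / x + y}.
Proof. by move=> x y; rewrite wedge.unlock tensDr raddfD. Qed.
Lemma wedge0r a : a ⋀ 0 = 0.
Proof. by rewrite wedge.unlock tens0r raddf0. Qed.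
Lemma wedge0l a : 0 ⋀ a = 0.
Proof. by rewrite wedge.unlock tens0l raddf0. Qed.
Lemma wedgeC a b : a ⋀ b = - (b ⋀ a).
Proof.
apply/eqP; rewrite -addr_eq0; have := wedgexx (a + b).
by rewrite wedgeDl !wedgeDr !wedgexx add0r addr0 => ->.
Qed.

End Ext2Theory.

(* An abelian group V embeds additively in a commutative ring, namely the
   trivial square-zero extension of int by V; this makes [ring] available for
   identities in V. *)
Definition trivext (V : zmodType) : Type := (int * V)%type.

Section TrivExt.
Variable V : zmodType.
HB.instance Definition _ := GRing.Zmodule.on (trivext V).

Let tmul (x y : trivext V) : trivext V :=
  (x.1 * y.1, x.2 *~ y.1 + y.2 *~ x.1).
Let tone : trivext V := (1, 0).

Lemma trivext_mulA : associative tmul.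
Proof.
move=> x y z; congr pair => /=; first by rewrite mulrA.
by rewrite !mulrzDl -!mulrzA addrA [y.1 * x.1]mulrC [z.1 * x.1]mulrC.
Qed.
Lemma trivext_mulC : commutative tmul.
Proof. by move=> x y; rewrite /tmul mulrC addrC. Qed.
Lemma trivext_mul1 : left_id tone tmul.
Proof. by case=> x1 x2; rewrite /tmul /= mul1r mul0rz add0r. Qed.
Lemma trivext_mulD : left_distributive tmul +%R.
Proof.
move=> x y z; congr pair => /=; first by rewrite mulrDl.
by rewrite mulrzDl mulrzDr addrACA.
Qed.
Lemma trivext_1 : tone != 0.
Proof. by []. Qed.

HB.instance Definition _ := GRing.Zmodule_isComNzRing.Build (trivext V)
  trivext_mulA trivext_mulC trivext_mul1 trivext_mulD trivext_1.

Definition to_trivext (v : V) : trivext V := (0, v).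
Lemma to_trivext_subproof : zmod_morphism to_trivext.
Proof. by move=> x y; congr pair; rewrite subr0. Qed.
HB.instance Definition _ := GRing.isZmodMorphism.Build V (trivext V)
  to_trivext to_trivext_subproof.
Lemma to_trivext_inj : injective to_trivext. Proof. by move=> x y []. Qed.

End TrivExt.

(** * The multiplicative group of a field, as a Z-module *)

Record units (F : fieldType) := Units { uval : F; _ : uval != 0 }.

Section Units.
Variable F : fieldType.
HB.instance Definition _ := [isSub for @uval F].
HB.instance Definition _ := [Choice of units F by <:].

Implicit Types u v w : units F.

Lemma uval_neq0 u : uval u != 0. Proof. exact: (valP u). Qed.

Let uone := Units (oner_neq0 F).
Let umul u v := Units (mulf_neq0 (uval_neq0 u) (uval_neq0 v)).
Lemma uval_inv_neq0 u : (uval u)^-1 != 0.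
Proof. by rewrite invr_eq0 uval_neq0. Qed.
Let uinv u := Units (uval_inv_neq0 u).

Lemma umulA : associative umul.
Proof. by move=> u v w; apply: val_inj; rewrite /= mulrA. Qed.
Lemma umulC : commutative umul.
Proof. by move=> u v; apply: val_inj; rewrite /= mulrC. Qed.
Lemma umul1 : left_id uone umul.
Proof. by move=> u; apply: val_inj; rewrite /= mul1r. Qed.
Lemma umulV : left_inverse uone uinv umul.
Proof. by move=> u; apply: val_inj; rewrite /= mulVf ?uval_neq0. Qed.

(* F^x is written additively from here on: u + v stands for the product. *)
HB.instance Definition _ :=
  GRing.isZmodule.Build (units F) umulA umulC umul1 umulV.

(* The unit x; only used for x != 0 (the value at 0 is the neutral element). *)
Definition unitof (x : F) : units F := insubd (0 : units F) x.

Lemma uvalE x : x != 0 -> uval (unitof x) = x.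
Proof. by move=> x0; rewrite -[uval _]/(val _) val_insubd x0. Qed.

Lemma unitof1 : unitof 1 = 0.
Proof. by apply: val_inj; rewrite /= uvalE ?oner_neq0. Qed.

Lemma unitofM x y : x != 0 -> y != 0 -> unitof (x * y) = unitof x + unitof y.
Proof.
by move=> x0 y0; apply: val_inj; rewrite /= !uvalE // mulf_neq0.
Qed.

Lemma unitofV x : x != 0 -> unitof x^-1 = - unitof x.
Proof.
by move=> x0; apply: val_inj; rewrite /= !uvalE // invr_eq0.
Qed.

Lemma unitof_div x y : x != 0 -> y != 0 ->
  unitof (x / y) = unitof x - unitof y.
Proof. by move=> x0 y0; rewrite unitofM ?invr_eq0 // unitofV. Qed.

Lemma two_neq0 : [pchar F] =i pred0 -> 2%:R != 0 :> F.
Proof. by move/pcharf0P => ->. Qed.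

Lemma tens_unitofN (charF0 : [pchar F] =i pred0) (x y : F) :
  x ⊗ unitof (- y) = x ⊗ unitof y.
Proof.
have [->|y0] := eqVneq y 0; first by rewrite oppr0.
have n0 : (-1 : F) != 0 by rewrite oppr_eq0 oner_neq0.
rewrite -mulN1r unitofM // tensDr [X in X + _](_ : _ = 0) ?add0r //.
have -> : x = x / 2%:R + x / 2%:R.
  by rewrite -mulr2n -[RHS]mulr_natr divfK ?two_neq0.
by rewrite tensDl -tensDr -unitofM // mulrNN mulr1 unitof1 tens0r.
Qed.

End Units.

(** * Dual numbers F[ε]/ε^2 *)

Notation "{ 'dual' F }" := {poly %/ ('X^2 : {poly F})}
  (at level 0, F at level 2, format "{ 'dual'  F }") : type_scope.

HB.lock Definition body (F : fieldType) (x : {dual F}) : F :=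
  (x : {poly F})`_0.
HB.lock Definition epsc (F : fieldType) (x : {dual F}) : F :=
  (x : {poly F})`_1.

Section Dual.
Variable F : fieldType.
Implicit Types x y : {dual F}.

Definition dual (a b : F) : {dual F} := a%:A + b *: 'qX.

Lemma dual_modE : mk_monic ('X^2 : {poly F}) = 'X^2.
Proof. by rewrite mk_monic_Xn. Qed.

Lemma poly_of_dual a b : dual a b = a%:P + b *: 'X :> {poly F}.
Proof.
have qXE : polyn ('qX : {dual F}) = 'X.
  by rewrite qpolyXE ?size_polyXn ?monicXn.
have -> : polyn (dual a b) = a *: 1%:P + b *: polyn ('qX : {dual F}) by [].
by rewrite qXE alg_polyC.
Qed.

Lemma body_dual a b : body (dual a b) = a.
Proof. by rewrite body.unlock poly_of_dual coefD coefZ coefX coefC mulr0 addr0. Qed.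

Lemma epsc_dual a b : epsc (dual a b) = b.
Proof. by rewrite epsc.unlock poly_of_dual coefD coefZ coefX coefC mulr1 add0r. Qed.

Lemma dual_eqP x y : body x = body y -> epsc x = epsc y -> x = y.
Proof.
rewrite body.unlock epsc.unlock => x0 x1.
apply/npolyP => -[|[|i]] //.
by rewrite !big_coef_npoly // dual_modE size_polyXn.
Qed.

Lemma bodyD x y : body (x + y) = body x + body y.
Proof. by rewrite body.unlock poly_of_qpolyD coefD. Qed.
Lemma epscD x y : epsc (x + y) = epsc x + epsc y.
Proof. by rewrite epsc.unlock poly_of_qpolyD coefD. Qed.

Lemma coef_dualM x y i : (i < 2)%N ->
  (x * y : {dual F})`_i = ((x : {poly F}) * (y : {poly F}))`_i.
Proof.
move=> i2; rewrite poly_of_qpolyM.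
move: (polyn x) (polyn y) => p q; rewrite dual_modE.
rewrite [in RHS](Pdiv.RingMonic.rdivp_eq (monicXn F 2) (p * q)).
by rewrite coefD coefMXn i2 add0r.
Qed.

Lemma bodyM x y : body (x * y) = body x * body y.
Proof. by rewrite body.unlock coef_dualM // coefM big_ord1. Qed.
Lemma epscM x y : epsc (x * y) = body x * epsc y + epsc x * body y.
Proof.
by rewrite body.unlock epsc.unlock coef_dualM // coefM big_ord_recl big_ord1.
Qed.

Lemma body1 : body (1 : {dual F}) = 1.
Proof. by rewrite body.unlock /= coefC. Qed.
Lemma bodyB x y : body (x - y) = body x - body y.
Proof. by apply: (addIr (body y)); rewrite subrK -bodyD subrK. Qed.
Lemma epscB x y : epsc (x - y) = epsc x - epsc y.
Proof. by apply: (addIr (epsc y)); rewrite subrK -epscD subrK. Qed.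
Lemma epsc1 : epsc (1 : {dual F}) = 0.
Proof. by rewrite epsc.unlock /= coefC. Qed.

Lemma dual_unitE x : (x \is a GRing.unit) = (body x != 0).
Proof.
apply/idP/idP => [xU | x0].
  apply: contraTneq (oner_neq0 F) => x0.
  by rewrite -body1 -(mulrV xU) bodyM x0 mul0r eqxx.
apply/unitrPr; exists (dual (body x)^-1 (- epsc x / body x ^+ 2)).
apply: dual_eqP.
  by rewrite bodyM body_dual body1 mulfV.
by rewrite epscM body_dual epsc_dual epsc1; field.
Qed.

Lemma body_div x y : body y != 0 -> body (x / y) = body x / body y.
Proof.
move=> y0; apply: (mulIf y0); rewrite -bodyM divrK ?dual_unitE //.
by rewrite divfK.
Qed.

Lemma epsc_div x y : body y != 0 ->
  epsc (x / y) = (body y * epsc x - body x * epsc y) / body y ^+ 2.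
Proof.
move=> y0; have := epscM (x / y) y.
rewrite divrK ?dual_unitE // body_div // => ->.
by field.
Qed.

End Dual.

(** * Configurations of vectors in the plane *)

(* Δ(u,v), the determinant of the 2 x 2 matrix with columns u and v. *)
HB.lock Definition Delta (R : comNzRingType) (u v : 'cV[R]_2) : R :=
  \det (row_mx u v : 'M[R]_2).

Lemma det_mx2 (R : comNzRingType) (A : 'M[R]_2) :
  \det A = A 0 0 * A 1 1 - A 0 1 * A 1 0.
Proof.
rewrite (expand_det_row _ 0) !big_ord_recl big_ord0 addr0 /cofactor !det_mx11.
rewrite !mxE /= expr0 expr1 mul1r mulN1r mulrN.
by congr (_ * A _ _ - A _ _ * A _ _); apply: val_inj.
Qed.

Lemma DeltaE (R : comNzRingType) (u v : 'cV[R]_2) :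
  Delta u v = u 0 0 * v 1 0 - v 0 0 * u 1 0.
Proof.
have rl a : (row_mx u v : 'M_2) a 0 = u a 0.
  by rewrite -[RHS](row_mxEl u v); congr (row_mx u v a _); apply: val_inj.
have rr a : (row_mx u v : 'M_2) a 1 = v a 0.
  by rewrite -[RHS](row_mxEr u v); congr (row_mx u v a _); apply: val_inj.
by rewrite Delta.unlock det_mx2 !rl !rr.
Qed.

Lemma Delta_mulmx (R : comNzRingType) (g : 'M[R]_2) (u v : 'cV[R]_2) :
  Delta (g *m u) (g *m v) = \det g * Delta u v.
Proof. by rewrite Delta.unlock -det_mulmx; congr (\det _); rewrite -mul_mx_row. Qed.

Lemma Delta_anti (R : comNzRingType) (u v : 'cV[R]_2) : Delta u v = - Delta v u.
Proof. by rewrite !DeltaE opprB. Qed.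

(* The logarithmic derivatives x'/x and x'/(1-x) of the five arguments. *)
Section FiveTermField.
Variables (F : fieldType) (a a' b b' : F).
Hypotheses (a0 : a != 0) (b0 : b != 0).
Hypotheses (a1 : 1 - a != 0) (b1 : 1 - b != 0) (ba : b - a != 0).

Lemma five_term_1B3 : 1 - b / a = - ((b - a) / a).
Proof. by field. Qed.
Lemma five_term_1B4 : 1 - (1 - b) / (1 - a) = (b - a) / (1 - a).
Proof. by field. Qed.
Lemma five_term_1B5 :
  1 - a * (1 - b) / (b * (1 - a)) = (b - a) / (b * (1 - a)).
Proof. by field; rewrite b0 a1. Qed.

Lemma five_term_dlog3 :
  (a * b' - a' * b) / a ^+ 2 / (b / a) = b' / b - a' / a.
Proof. by field; rewrite b0 a0. Qed.
Lemma five_term_dlog3' : (a * b' - a' * b) / a ^+ 2 / (- ((b - a) / a)) =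
  a' / a - (b' - a') / (b - a).
Proof. by field; rewrite oppr_eq0 a0 ba. Qed.
Lemma five_term_dlog4 :
  ((1 - b) * a' - (1 - a) * b') / (1 - a) ^+ 2 / ((1 - b) / (1 - a)) =
  a' / (1 - a) - b' / (1 - b).
Proof. by field; rewrite a1 b1. Qed.
Lemma five_term_dlog4' :
  ((1 - b) * a' - (1 - a) * b') / (1 - a) ^+ 2 / ((b - a) / (1 - a)) =
  - ((b' - a') / (b - a)) - a' / (1 - a).
Proof. by field; rewrite a1 ba. Qed.
Lemma five_term_dlog5 :
  (b * (1 - b) * a' - a * (1 - a) * b') / (b * (1 - a)) ^+ 2
    / (a * (1 - b) / (b * (1 - a))) =
  a' / a - b' / (1 - b) - b' / b + a' / (1 - a).
Proof. by field; rewrite a0 b0 a1 b1. Qed.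
Lemma five_term_dlog5' :
  (b * (1 - b) * a' - a * (1 - a) * b') / (b * (1 - a)) ^+ 2
    / ((b - a) / (b * (1 - a))) =
  b' / b - (b' - a') / (b - a) - a' / (1 - a).
Proof. by field; rewrite b0 a1 ba. Qed.
End FiveTermField.

Section Configurations.
Variable F : fieldType.

(* The parts l and l_ε of l^* = l + l_ε ε. *)
Definition vbody (u : 'cV[{dual F}]_2) : 'cV[F]_2 := map_mx (@body F) u.
Definition veps (u : 'cV[{dual F}]_2) : 'cV[F]_2 := map_mx (@epsc F) u.

(* Δ(u,v)_ε *)
Definition Delta_eps (u v : 'cV[{dual F}]_2) : F :=
  Delta (veps u) (vbody v) + Delta (vbody u) (veps v).

Lemma body_Delta u v : body (Delta u v) = Delta (vbody u) (vbody v).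
Proof. by rewrite !DeltaE bodyB !bodyM !mxE. Qed.

Lemma epsc_Delta u v : epsc (Delta u v) = Delta_eps u v.
Proof. by rewrite /Delta_eps !DeltaE epscB !epscM !mxE; ring. Qed.

(* An m-tuple of vectors is the 2 x m matrix with these vectors as columns. *)
Definition generic m (L : 'M[{dual F}]_(2, m)) : bool :=
  [forall i, vbody (col i L) != 0] &&
  [forall i, forall j, (i != j) ==>
     (Delta (vbody (col i L)) (vbody (col j L)) != 0)].

Record gtuple m := GTuple {
  vecs :> 'M[{dual F}]_(2, m);
  gtupleP : generic vecs
}.
HB.instance Definition _ m := [isSub for @vecs m].
HB.instance Definition _ m := [Choice of gtuple m by <:].

(* L and L' are in the same orbit of the diagonal action of GL_2. *)
Definition gl_equiv m (L L' : gtuple m) : bool :=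
  `[< exists2 g : 'M[{dual F}]_2, g \in unitmx & vecs L' = g *m vecs L >].

Lemma gl_equiv_refl m : reflexive (@gl_equiv m).
Proof.
move=> L; apply/asboolP; exists 1%:M; first exact: unitmx1.
by rewrite mul1mx.
Qed.

Lemma gl_equiv_sym m : symmetric (@gl_equiv m).
Proof.
suff sub (L L' : gtuple m) : gl_equiv L L' -> gl_equiv L' L.
  by move=> L L'; apply/idP/idP; apply: sub.
move=> /asboolP[g gU LE]; apply/asboolP; exists (invmx g).
  by rewrite unitmx_inv.
by rewrite LE mulKmx.
Qed.

Lemma gl_equiv_trans m : transitive (@gl_equiv m).
Proof.
move=> L2 L1 L3 /asboolP[g gU E12] /asboolP[h hU E23]; apply/asboolP.
exists (h *m g); first by rewrite unitmx_mul hU.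
by rewrite E23 E12 mulmxA.
Qed.

Canonical gl_equiv_rel m :=
  EquivRel (@gl_equiv m) (@gl_equiv_refl m) (@gl_equiv_sym m)
    (@gl_equiv_trans m).

Definition config m := {eq_quot (@gl_equiv m)}.
HB.instance Definition _ m := Choice.on (config m).

(* C_m(A^2_{F[ε]_2}) *)
Definition Cgrp m := {freeg (config m)}.
HB.instance Definition _ m := GRing.Zmodule.on (Cgrp m).

Definition cfg m (L : gtuple m) : Cgrp m :=
  << (\pi_{eq_quot (@gl_equiv m)} L : config m) >>.

(* The additive map on C_m induced by a GL_2-invariant map on tuples. *)
Definition clift m (M : zmodType) (f : gtuple m -> M)
    (finv : forall L L', gl_equiv L L' -> f L = f L') : Cgrp m -> M :=
  zlift (fun q : config m => f (repr q)).

Section CLift.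
Variables (m : nat) (M : zmodType) (f : gtuple m -> M).
Hypothesis finv : forall L L', gl_equiv L L' -> f L = f L'.

HB.instance Definition _ := GRing.isZmodMorphism.Build (Cgrp m) M (clift finv)
  (zlift_is_zmod_morphism _).

Lemma cliftE L : clift finv (cfg L) = f L.
Proof.
rewrite /clift /cfg zliftU; apply: finv; apply/eqmodP.
by rewrite reprK.
Qed.

End CLift.

Lemma cfg_eq m (L L' : gtuple m) : gl_equiv L L' -> cfg L = cfg L'.
Proof. by move=> LL'; congr << _ >>; apply/eqmodP. Qed.

Lemma eq_from_cfg m (M : zmodType) (f g : {additive Cgrp m -> M}) :
  (forall L, f (cfg L) = g (cfg L)) -> f =1 g.
Proof. by move=> fg; apply: eq_from_freeg => q; rewrite -(reprK q) fg. Qed.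

(* (l_0, ..., l_m) with l_i omitted *)
Lemma generic_col' m (i : 'I_m.+1) (L : gtuple m.+1) :
  generic (col' i (vecs L) : 'M_(2, m)).
Proof.
have colE (j : 'I_m) : col j (col' i (vecs L) : 'M_(2, m)) = col (lift i j) L.
  by apply/matrixP => k l; rewrite !mxE.
have /andP[/forallP L0 /forallP LD] := gtupleP L.
apply/andP; split; apply/forallP => j; rewrite ?colE //.
apply/forallP => k; apply/implyP => jk; rewrite !colE.
by apply: (implyP (forallP (LD _) _)); rewrite (inj_eq lift_inj).
Qed.

Definition face m (i : 'I_m.+1) (L : gtuple m.+1) : gtuple m :=
  GTuple (generic_col' i L).

Definition Cdiff_gen m (L : gtuple m.+1) : Cgrp m :=
  \sum_(i < m.+1) cfg (face i L) *~ (-1) ^+ i.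

Lemma Cdiff_gen_inv m (L L' : gtuple m.+1) : gl_equiv L L' -> Cdiff_gen L = Cdiff_gen L'.
Proof.
move=> /asboolP[g gU LE]; apply: eq_bigr => i _; congr (_ *~ _).
apply/cfg_eq/asboolP; exists g => //=; rewrite LE.
by apply/matrixP => j k; rewrite !mxE; apply: eq_bigr => l _; rewrite !mxE.
Qed.

Definition Cdiff m : Cgrp m.+1 -> Cgrp m := clift (@Cdiff_gen_inv m).
HB.instance Definition _ m := GRing.Additive.on (@Cdiff m).

Lemma CdiffE m L : @Cdiff m (cfg L) = \sum_(i < m.+1) cfg (face i L) *~ (-1) ^+ i.
Proof. exact: cliftE. Qed.

(* The vectors l^*_i, and the determinants Δ(l^*_i,l^*_j), Δ(l_i,l_j) and
   Δ(l^*_i,l^*_j)_ε, for 0 <= i, j <= m. *)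
Definition vec m (L : gtuple m.+1) (i : nat) : 'cV[{dual F}]_2 :=
  col (inord i) L.
Definition Dst m (L : gtuple m.+1) (i j : nat) : {dual F} :=
  Delta (vec L i) (vec L j).
Definition Dbd m (L : gtuple m.+1) (i j : nat) : F :=
  Delta (vbody (vec L i)) (vbody (vec L j)).
Definition Dep m (L : gtuple m.+1) (i j : nat) : F :=
  Delta_eps (vec L i) (vec L j).

Section Determinants.
Variables (m : nat).
Implicit Types (L : gtuple m.+1) (i j : nat).

Lemma body_Dst L i j : body (Dst L i j) = Dbd L i j.
Proof. exact: body_Delta. Qed.
Lemma epsc_Dst L i j : epsc (Dst L i j) = Dep L i j.
Proof. exact: epsc_Delta. Qed.

Lemma Dbd_neq0 L i j : (i <= m)%N -> (j <= m)%N -> i != j -> Dbd L i j != 0.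
Proof.
move=> im jm ij; have /andP[_ /forallP LD] := gtupleP L.
apply: (implyP (forallP (LD _) _)); apply: contraNneq ij => /(congr1 val) /=.
by rewrite !inordK // => ->.
Qed.

Lemma Dbd_anti L i j : Dbd L i j = - Dbd L j i.
Proof. exact: Delta_anti. Qed.

Lemma Dst_gl L L' : gl_equiv L L' ->
  exists2 c, c \is a GRing.unit & forall i j, Dst L' i j = c * Dst L i j.
Proof.
move=> /asboolP[g gU LE]; exists (\det g); first by rewrite -unitmxE.
move=> i j; rewrite /Dst -Delta_mulmx /vec LE.
by congr Delta; apply/matrixP => a b; rewrite !mxE;
  apply: eq_bigr => k _; rewrite !mxE.
Qed.

Lemma Dbd_Dep_gl L L' : gl_equiv L L' -> exists c t : F,
  [/\ c != 0, forall i j, Dbd L' i j = c * Dbd L i j &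
      forall i j, Dbd L i j != 0 ->
        Dep L' i j / Dbd L' i j = Dep L i j / Dbd L i j + t].
Proof.
move=> /Dst_gl[c]; rewrite dual_unitE => c0 LE.
have DE i j : Dbd L' i j = body c * Dbd L i j.
  by rewrite -!body_Dst LE bodyM.
exists (body c), (epsc c / body c); split=> // i j D0.
by rewrite DE -!epsc_Dst LE epscM body_Dst; field; rewrite D0 c0.
Qed.

End Determinants.

Lemma plucker (L : gtuple 4) :
  Dbd L 0 2 * Dbd L 1 3 = Dbd L 0 1 * Dbd L 2 3 + Dbd L 0 3 * Dbd L 1 2.
Proof. by rewrite /Dbd !DeltaE; ring. Qed.

End Configurations.

(** * The map τ^2_0,ε *)

Section Maps.
Variable F : fieldType.

Definition target : zmodType := (tensor F (units F) * ext2 F)%type.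

Definition tau0_1 (L : gtuple F 3) : tensor F (units F) :=
    (Dep L 1 2 / Dbd L 1 2) ⊗ unitof (Dbd L 0 2 / Dbd L 0 1)
  - (Dep L 0 2 / Dbd L 0 2) ⊗ unitof (Dbd L 1 2 / Dbd L 1 0)
  + (Dep L 0 1 / Dbd L 0 1) ⊗ unitof (Dbd L 2 1 / Dbd L 2 0).

Definition tau0_2 (L : gtuple F 3) : ext2 F :=
    (Dep L 0 1 / Dbd L 0 1) ⋀ (Dep L 1 2 / Dbd L 1 2)
  - (Dep L 0 1 / Dbd L 0 1) ⋀ (Dep L 0 2 / Dbd L 0 2)
  + (Dep L 1 2 / Dbd L 1 2) ⋀ (Dep L 0 2 / Dbd L 0 2).

Definition tau0_gen (L : gtuple F 3) : target := (tau0_1 L, tau0_2 L).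

Lemma tau0_gen_inv (charF0 : [pchar F] =i pred0) L L' :
  gl_equiv L L' -> tau0_gen L = tau0_gen L'.
Proof.
move=> /Dbd_Dep_gl[c [t [c0 DE XE]]].
have D01 : Dbd L 0 1 != 0 by apply: Dbd_neq0.
have D02 : Dbd L 0 2 != 0 by apply: Dbd_neq0.
have D12 : Dbd L 1 2 != 0 by apply: Dbd_neq0.
have DA := Dbd_anti L.
rewrite /tau0_gen /tau0_1 /tau0_2.
move: {L L'} (Dbd L) (Dbd L') (Dep L) (Dep L') D01 D02 D12 DA DE XE.
move=> D D' E E' D01 D02 D12 DA DE XE.
rewrite !XE // !DE -!mulf_div !divff // !mul1r.
rewrite [D 1 0]DA [D 2 1]DA [D 2 0]DA !invrN !mulrN !mulNr opprK.
rewrite !tens_unitofN // !unitof_div //.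
congr pair.
  by rewrite !tensDl !tensBr; apply: to_trivext_inj; ring.
rewrite !wedgeDl !wedgeDr !wedgexx ![t ⋀ _]wedgeC.
by apply: to_trivext_inj; ring.
Qed.

Definition tau0 (charF0 : [pchar F] =i pred0) : Cgrp F 3 -> target :=
  clift (tau0_gen_inv charF0).
HB.instance Definition _ charF0 := GRing.Additive.on (tau0 charF0).

Lemma tau0E charF0 L : tau0 charF0 (cfg L) = (tau0_1 L, tau0_2 L).
Proof. exact: cliftE. Qed.


(** * The group TB_2(F) and the map ∂_ε *)

(* ⟨a;b] in Z[F[ε]_2] *)
Definition brk (a b : F) : {freeg {dual F}} :=
  << dual a b >> - << dual a 0 >>.

Inductive is_brk : {freeg {dual F}} -> Prop :=
  | IsBrk a b of a != 0 & a != 1 : is_brk (brk a b).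

(* The subgroup of Z[F[ε]_2] generated by the ⟨a;b] with a != 0, 1. *)
Record brk_group := BrkGroup {
  brk_val : {freeg {dual F}};
  _ : brk_val \in zspan is_brk
}.
HB.instance Definition _ := [isSub for brk_val].
HB.instance Definition _ := [Choice of brk_group by <:].
HB.instance Definition _ := [SubChoice_isSubZmodule of brk_group by <:].

Inductive five_term (x : brk_group) : Prop :=
  | FiveTerm (a a' b b' : F) of
        a != 0 & a != 1 & b != 0 & b != 1 & a != b
      & brk_val x =
          brk a a' - brk b b'
          + brk (b / a) ((a * b' - a' * b) / a ^+ 2)
          - brk ((1 - b) / (1 - a))
              (((1 - b) * a' - (1 - a) * b') / (1 - a) ^+ 2)
          + brk ((a * (1 - b)) / (b * (1 - a)))
              ((b * (1 - b) * a' - a * (1 - a) * b') / (b * (1 - a)) ^+ 2).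

Definition TB2 := zquot five_term.
HB.instance Definition _ := GRing.Zmodule.on TB2.

(* ⟨a;b]_2; only used for a != 0, 1, see [brkE] (it is 0 otherwise). *)
Definition brk2 (a b : F) : TB2 :=
  zcl five_term (insubd (0 : brk_group) (brk a b)).

Lemma brkE a b : a != 0 -> a != 1 ->
  brk_val (insubd (0 : brk_group) (brk a b)) = brk a b.
Proof.
move=> a0 a1; rewrite -[brk_val _]/(val _) val_insubd.
by rewrite mem_zspan //; constructor.
Qed.

Definition partial_gen (a b : F) : target :=
  ((b / a) ⊗ unitof (1 - a) + (b / (1 - a)) ⊗ unitof a,
   (b / (1 - a)) ⋀ (b / a)).

(* The additive map Z[F[ε]_2] -> target with [a + bε] |-> partial_gen a b for
   a != 0, 1. As partial_gen a 0 = 0, its restriction to brk_group sends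
   ⟨a;b] = [a + bε] - [a] to partial_gen a b, see [partial_ambE]. *)
Definition partial_amb : {freeg {dual F}} -> target :=
  zlift (fun x => if (body x != 0) && (body x != 1)
                  then partial_gen (body x) (epsc x) else 0).
HB.instance Definition _ := GRing.Additive.on partial_amb.

Lemma partial_ambE a b : a != 0 -> a != 1 ->
  partial_amb (brk a b) = partial_gen a b.
Proof.
move=> a0 a1; rewrite /brk raddfB /= /partial_amb !zliftU !body_dual !epsc_dual.
rewrite a0 a1 /= [X in _ - X](_ : _ = 0) ?subr0 //.
by rewrite /partial_gen !mul0r !tens0l wedge0r addr0.
Qed.

Definition partial_sub : brk_group -> target := partial_amb \o brk_val.
Lemma partial_sub_is_zmod_morphism : zmod_morphism partial_sub.
Proof. by move=> x y; rewrite /partial_sub /= -raddfB. Qed.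
HB.instance Definition _ := GRing.isZmodMorphism.Build brk_group target
  partial_sub partial_sub_is_zmod_morphism.

Lemma partial_five_term (charF0 : [pchar F] =i pred0) (x : brk_group) :
  five_term x -> partial_sub x = 0.
Proof.
case=> a a' b b' a0 a1 b0 b1 ab xE; rewrite /partial_sub /= xE.
have a1' : 1 - a != 0 by rewrite subr_eq0 eq_sym.
have b1' : 1 - b != 0 by rewrite subr_eq0 eq_sym.
have ba' : b - a != 0 by rewrite subr_eq0 eq_sym.
have ba1 : b / a != 1.
  by apply: contraNneq ab => /(canRL (divfK a0)); rewrite mul1r => ->.
have ba0 : b / a != 0 by rewrite mulf_neq0 ?invr_eq0.
have q0 : (1 - b) / (1 - a) != 0 by rewrite mulf_neq0 ?invr_eq0.
have q1 : (1 - b) / (1 - a) != 1.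
  apply: contraNneq ab => /(canRL (divfK a1')); rewrite mul1r => /addrI.
  by move/oppr_inj => ->.
have ba1' : b * (1 - a) != 0 by rewrite mulf_neq0.
have s0 : a * (1 - b) / (b * (1 - a)) != 0 by rewrite !mulf_neq0 ?invr_eq0.
have s1 : a * (1 - b) / (b * (1 - a)) != 1.
  apply: contraNneq ab => /(canRL (divfK ba1')); rewrite mul1r !mulrBr !mulr1.
  by rewrite [b * a]mulrC => /addIr ->.
rewrite raddfD raddfB raddfD raddfB /= !partial_ambE // /partial_gen.
rewrite five_term_1B3 // five_term_1B4 // five_term_1B5 //.
rewrite five_term_dlog3 // five_term_dlog3' // five_term_dlog4 //.
rewrite five_term_dlog4' // five_term_dlog5 // five_term_dlog5' //.
rewrite !tens_unitofN // !unitof_div ?mulf_neq0 // !unitofM //.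
move: (a' / a) (b' / b) (a' / (1 - a)) (b' / (1 - b)) ((b' - a') / (b - a)).
move: (unitof a) (unitof b) (unitof (1 - a)) (unitof (1 - b)) (unitof (b - a)).
move=> u v w x' y al be pi rh ga.
congr pair => /=.
  rewrite !(tensDl, tensBl, tensNl, tensDr, tensBr).
  by apply: to_trivext_inj; ring.
rewrite !(wedgeDl, wedgeBl, wedgeNl, wedgeDr, wedgeBr, wedgeNr) !wedgexx.
rewrite ?[be ⋀ al]wedgeC ?[pi ⋀ al]wedgeC ?[pi ⋀ be]wedgeC ?[rh ⋀ al]wedgeC.
rewrite ?[rh ⋀ be]wedgeC ?[rh ⋀ pi]wedgeC ?[ga ⋀ al]wedgeC ?[ga ⋀ be]wedgeC.
rewrite ?[ga ⋀ pi]wedgeC ?[ga ⋀ rh]wedgeC.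
by apply: to_trivext_inj; ring.
Qed.

Definition partial_eps (charF0 : [pchar F] =i pred0) : TB2 -> target :=
  qlift (@partial_five_term charF0).
HB.instance Definition _ charF0 := GRing.Additive.on (partial_eps charF0).

Lemma partial_epsE charF0 a b : a != 0 -> a != 1 ->
  partial_eps charF0 (brk2 a b) =
    ((b / a) ⊗ unitof (1 - a) + (b / (1 - a)) ⊗ unitof a,
     (b / (1 - a)) ⋀ (b / a)).
Proof.
by move=> a0 a1; rewrite /partial_eps /brk2 qliftE /= /partial_sub /= brkE //
  partial_ambE.
Qed.

(** * The map τ^2_1,ε *)

Definition cross_ratio (L : gtuple F 4) : {dual F} :=
  (Dst L 0 3 * Dst L 1 2) / (Dst L 0 2 * Dst L 1 3).

Lemma divr_mul2l (R : comUnitRingType) (c a b x y : R) :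
    c \is a GRing.unit -> x \is a GRing.unit -> y \is a GRing.unit ->
  c * a * (c * b) / (c * x * (c * y)) = a * b / (x * y).
Proof.
move=> cU xU yU; have U : c * x * (c * y) \is a GRing.unit.
  by rewrite !unitrM cU xU yU.
apply: (mulIr U); rewrite divrK // (mulrACA c a) (mulrACA c x) [RHS]mulrCA divrK //.
by rewrite unitrM xU.
Qed.

Lemma cross_ratio_inv (L L' : gtuple F 4) :
  gl_equiv L L' -> cross_ratio L = cross_ratio L'.
Proof.
move=> /Dst_gl[c cU LE]; rewrite /cross_ratio !LE.
have U02 : Dst L 0 2 \is a GRing.unit by rewrite dual_unitE body_Dst Dbd_neq0.
have U13 : Dst L 1 3 \is a GRing.unit by rewrite dual_unitE body_Dst Dbd_neq0.
exact/esym/divr_mul2l.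
Qed.

Lemma body_cross_ratio (L : gtuple F 4) : body (cross_ratio L) =
  (Dbd L 0 3 * Dbd L 1 2) / (Dbd L 0 2 * Dbd L 1 3).
Proof.
by rewrite body_div !bodyM !body_Dst // mulf_neq0 // Dbd_neq0.
Qed.

Lemma cross_ratio_neq0 (L : gtuple F 4) : body (cross_ratio L) != 0.
Proof.
by rewrite body_cross_ratio !mulf_neq0 ?invr_eq0 ?mulf_neq0 ?Dbd_neq0.
Qed.

Lemma cross_ratio_neq1 (L : gtuple F 4) : body (cross_ratio L) != 1.
Proof.
have D0 : Dbd L 0 2 * Dbd L 1 3 != 0 by rewrite mulf_neq0 ?Dbd_neq0.
have : Dbd L 0 1 * Dbd L 2 3 != 0 by rewrite mulf_neq0 ?Dbd_neq0.
apply: contraNneq; rewrite body_cross_ratio => /(canRL (divfK D0)).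
by rewrite mul1r plucker => /esym/eqP; rewrite -subr_eq0 addrK.
Qed.

Definition tau1_gen (L : gtuple F 4) : TB2 :=
  brk2 (body (cross_ratio L)) (epsc (cross_ratio L)).

Lemma tau1_gen_inv (L L' : gtuple F 4) :
  gl_equiv L L' -> tau1_gen L = tau1_gen L'.
Proof. by rewrite /tau1_gen => /cross_ratio_inv ->. Qed.

Definition tau1 : Cgrp F 4 -> TB2 := clift tau1_gen_inv.
HB.instance Definition _ := GRing.Additive.on tau1.

Lemma tau1E L : tau1 (cfg L) =
  brk2 (body (cross_ratio L)) (epsc (cross_ratio L)).
Proof. exact: cliftE. Qed.

End Maps.

(* Main.v *)
(** By the Plücker relation, both r and 1 - r are quotients of products of two
    determinants Δ(l^*_i,l^*_j). Hence r_ε/r and r_ε/(1 - r) are signed sums of the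
    Δ(l^*_i,l^*_j)_ε/Δ(l_i,l_j), and after multilinear expansion the two composites
    agree term by term; signs in F^× do not matter because F is 2-divisible. *)

Require Import Defs.
From mathcomp Require Import all_boot all_order all_algebra.
From mathcomp Require Import ring.

Import GRing.Theory.

Set Implicit Arguments.
Unset Strict Implicit.
Unset Printing Implicit Defensive.

Local Open Scope ring_scope.

Section CrossRatio.
Variable F : fieldType.

(** The bound on [j] keeps both uses of [inord] in range, away from its default value. *)
Lemma vec_face m (L : gtuple F m.+2) (i : 'I_m.+2) (j : nat) :
  (j <= m)%N -> vec (face i L) j = vec L (bump i j).
Proof.
move=> jm; apply/matrixP => a b; rewrite !mxE; congr (vecs L a _).
apply: val_inj; rewrite /= !inordK // /bump -addnS.
exact: leq_add (leq_b1 _) _.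
Qed.

Lemma Dbd_face m (L : gtuple F m.+2) (i : 'I_m.+2) (j k : nat) :
  (j <= m)%N -> (k <= m)%N ->
  Dbd (face i L) j k = Dbd L (bump i j) (bump i k).
Proof. by move=> jm km; rewrite /Dbd !vec_face. Qed.

Lemma Dep_face m (L : gtuple F m.+2) (i : 'I_m.+2) (j k : nat) :
  (j <= m)%N -> (k <= m)%N ->
  Dep (face i L) j k = Dep L (bump i j) (bump i k).
Proof. by move=> jm km; rewrite /Dep !vec_face. Qed.

Lemma one_sub_cross_ratio (L : gtuple F 4) : 1 - body (cross_ratio L) =
  (Dbd L 0 1 * Dbd L 2 3) / (Dbd L 0 2 * Dbd L 1 3).
Proof.
have D0 : Dbd L 0 2 * Dbd L 1 3 != 0 by rewrite mulf_neq0 ?Dbd_neq0.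
by rewrite body_cross_ratio -{1}(divff D0) -mulrBl {1}plucker addrK.
Qed.

(** The $\varepsilon$-coefficient of the Plücker relation over the dual numbers. *)
Lemma epsc_plucker (L : gtuple F 4) :
  Dep L 0 2 * Dbd L 1 3 + Dbd L 0 2 * Dep L 1 3 =
  Dep L 0 1 * Dbd L 2 3 + Dbd L 0 1 * Dep L 2 3
  + (Dep L 0 3 * Dbd L 1 2 + Dbd L 0 3 * Dep L 1 2).
Proof. by rewrite /Dep /Dbd /Delta_eps !DeltaE; ring. Qed.

Lemma dlog_cross_ratio (L : gtuple F 4) :
  epsc (cross_ratio L) / body (cross_ratio L) =
  Dep L 0 3 / Dbd L 0 3 + Dep L 1 2 / Dbd L 1 2
  - Dep L 0 2 / Dbd L 0 2 - Dep L 1 3 / Dbd L 1 3.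
Proof.
have D02 : Dbd L 0 2 != 0 by apply: Dbd_neq0.
have D03 : Dbd L 0 3 != 0 by apply: Dbd_neq0.
have D12 : Dbd L 1 2 != 0 by apply: Dbd_neq0.
have D13 : Dbd L 1 3 != 0 by apply: Dbd_neq0.
rewrite body_cross_ratio /cross_ratio epsc_div ?bodyM ?body_Dst ?mulf_neq0 //.
rewrite !epscM !body_Dst !epsc_Dst.
by field; rewrite D02 D03 D12 D13.
Qed.

(** The left side is minus the logarithmic derivative of $1-r$, so the denominators of $1-r$
    contribute with a plus sign. *)
Lemma dlog_one_sub_cross_ratio (L : gtuple F 4) :
  epsc (cross_ratio L) / (1 - body (cross_ratio L)) =
  Dep L 0 2 / Dbd L 0 2 + Dep L 1 3 / Dbd L 1 3
  - Dep L 0 1 / Dbd L 0 1 - Dep L 2 3 / Dbd L 2 3.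
Proof.
have D01 : Dbd L 0 1 != 0 by apply: Dbd_neq0.
have D02 : Dbd L 0 2 != 0 by apply: Dbd_neq0.
have D13 : Dbd L 1 3 != 0 by apply: Dbd_neq0.
have D23 : Dbd L 2 3 != 0 by apply: Dbd_neq0.
rewrite one_sub_cross_ratio /cross_ratio epsc_div ?bodyM ?body_Dst ?mulf_neq0 //.
rewrite !epscM !body_Dst !epsc_Dst.
(* Both forms of the Plücker relation eliminate the index pairs 03 and 12, leaving an identity in
   free variables for [field]. *)
have -> : Dbd L 0 3 * Dbd L 1 2 =
    Dbd L 0 2 * Dbd L 1 3 - Dbd L 0 1 * Dbd L 2 3.
  by rewrite plucker; ring.
have -> : Dbd L 0 3 * Dep L 1 2 + Dep L 0 3 * Dbd L 1 2 =
    Dep L 0 2 * Dbd L 1 3 + Dbd L 0 2 * Dep L 1 3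
    - (Dep L 0 1 * Dbd L 2 3 + Dbd L 0 1 * Dep L 2 3).
  by rewrite epsc_plucker; ring.
by field; rewrite D01 D02 D13 D23.
Qed.

End CrossRatio.

(** Swapping indices only changes signs, which vanish in $F\otimes F^\times$; hence every
    determinant can be written with increasing indices. *)
Lemma tau0_1E (F : fieldType) (charF0 : [pchar F] =i pred0) (L : gtuple F 3) :
  tau0_1 L =
    (Dep L 1 2 / Dbd L 1 2) ⊗ (unitof (Dbd L 0 2) - unitof (Dbd L 0 1))
  - (Dep L 0 2 / Dbd L 0 2) ⊗ (unitof (Dbd L 1 2) - unitof (Dbd L 0 1))
  + (Dep L 0 1 / Dbd L 0 1) ⊗ (unitof (Dbd L 1 2) - unitof (Dbd L 0 2)).
Proof.
rewrite /tau0_1 (Dbd_anti L 1 0) (Dbd_anti L 2 1) (Dbd_anti L 2 0).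
by rewrite !(invrN, mulrN, mulNr) opprK !tens_unitofN // !unitof_div ?Dbd_neq0.
Qed.

Lemma tau0_Cdiff_cfg (F : fieldType) (charF0 : [pchar F] =i pred0)
    (L : gtuple F 4) :
  tau0 charF0 (Cdiff (cfg L)) = partial_eps charF0 (tau1 (cfg L)).
Proof.
(* Generic position gives $r\neq0,1$, so [brk2] does not take its default value. *)
rewrite tau1E partial_epsE ?cross_ratio_neq0 ?cross_ratio_neq1 //.
rewrite dlog_cross_ratio dlog_one_sub_cross_ratio one_sub_cross_ratio.
rewrite body_cross_ratio CdiffE !big_ord_recl big_ord0 addr0.
rewrite !raddfD /= !raddfMz /= !tau0E.
have D i j : (i <= 3)%N -> (j <= 3)%N -> i != j -> Dbd L i j != 0.
  exact: Dbd_neq0.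
rewrite !tau0_1E // /tau0_2 !Dbd_face // !Dep_face //=.
rewrite /bump /= !(addn0, add0n) !addnS !addn0 /=.
rewrite !unitof_div ?unitofM ?mulf_neq0 ?D //.
(* Plücker has done its work: what remains holds for six arbitrary elements of $F$ and six arbitrary
   units. *)
move: (Dbd L) (Dep L) => d e.
move: (e 0 1 / _) (e 0 2 / _) (e 0 3 / _) => x01 x02 x03.
move: (e 1 2 / _) (e 1 3 / _) (e 2 3 / _) => x12 x13 x23.
move: (unitof (d 0 1)) (unitof (d 0 2)) (unitof (d 0 3)) => u01 u02 u03.
move: (unitof (d 1 2)) (unitof (d 1 3)) (unitof (d 2 3)) => u12 u13 u23.
rewrite !(expr0, exprS, mulr1, mulN1r, opprK, mulr1z, mulrN1z).
congr pair => /=.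
  rewrite !(tensDl, tensNl, tensDr, tensNr).
  by apply: to_trivext_inj; ring.
rewrite !(wedgeDl, wedgeNl, wedgeDr, wedgeNr) !wedgexx.
(* [ring] sees wedges as unrelated atoms, so each pair is put in lexicographic order. *)
rewrite [x12 ⋀ x02]wedgeC [x13 ⋀ x03]wedgeC [x13 ⋀ x12]wedgeC.
rewrite [x13 ⋀ x02]wedgeC [x23 ⋀ x03]wedgeC [x23 ⋀ x12]wedgeC.
rewrite [x23 ⋀ x02]wedgeC [x23 ⋀ x13]wedgeC.
by apply: to_trivext_inj; ring.
Qed.

Theorem lemma4p2 (F : fieldType) (charF0 : [pchar F] =i pred0) (c : Cgrp F 4) :
  tau0 charF0 (Cdiff c) = partial_eps charF0 (tau1 c).
Proof.
(* Both composites are additive, so agreement on single configurations suffices. *)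
exact: (eq_from_cfg (f := tau0 charF0 \o @Cdiff F 3)
  (g := partial_eps charF0 \o @tau1 F) (tau0_Cdiff_cfg charF0)).
Qed.
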